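(* Let $d>0$ and $\lambda>0$. For $y>0$ define the conjugate function $$c(y):=\sup_{x>d}\{U(x-d)-x\lambda y\}=U(I(\lambda y))-\lambda yI(\lambda y)-\lambda yd .$$ (i) $c(y)$ is decreasing in $y$. (ii) For each fixed $d>0$ there exists $\hat d$ (called the tangent point of $U(x-d)$) such that $U(\hat d-d)/\hat d=U'(\hat d-d)$. Moreover, with $y(\hat d):=U'(\hat d-d)/\lambda$, we have $c(y(\hat d))=0$, and $y(\hat d)$ is the unique zero root of $c$. (iii) If $y>y(\hat d)$, then $U(x(y)-d)/x(y)-U'(x(y)-d)<0$, where $x(y)=I(\lambda y)+d$. (iv) For positive $\lambda,\lambda_2,l,d$, define $$c^{*}(y):=\sup_{x>d}\left\{U(x-d)-x\lambda y+\lambda y\tfrac{\lambda_2l}{\lambda}\right\}=U(I(\lambda y))-\lambda yI(\lambda y)-\lambda yd+\lambda y\tfrac{\lambda_2l}{\lambda}.$$ Then $c^{*}$ has a zero root if and only if $s:=\frac{\lambda_2l}{\lambda}-d<0$. (v) For positive $\lambda,\lambda_3,l,d$, define $c^{**}(y):=\sup_{x>d}\{U(x-d)-x\lambda y+\lambda_3l\}=c(y)+\lambda_3l$. Then $c^{**}$ has a zero root $y^{**}$, and $y^{**}>y(\hat d)$. (vi) The conjugate function $$c^{***}(y):=\sup_{x>-d}\{U(x+d)-x\lambda y\}=U(I(\lambda y))-\lambda yI(\lambda y)+\lambda yd$$ (with maximizer $x(y)=I(\lambda y)-d$) decreases on $(0,U'(d)/\lambda)$, increases on $(U'(d)/\lambda,\infty)$,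 and hence has the minimum value $U(d)$.
   Context: $U:[0,\infty)\to\mathbb R$ is strictly increasing, strictly concave, continuously differentiable on $(0,\infty)$, bounded from below with $U(0)=0$, and satisfies the Inada conditions $\lim_{x\to0}U'(x)=\infty$, $\lim_{x\to\infty}U'(x)=0$ and the asymptotic elasticity condition $\limsup_{x\to\infty}xU'(x)/U(x)<1$. $I=(U')^{-1}:(0,\infty)\to(0,\infty)$ is the inverse function of $U'$. A zero root of a function on $(0,\infty)$ is a point $y>0$ where it vanishes. *)

(* Defs.v *)
From mathcomp Require Import all_boot all_order all_algebra.
From mathcomp Require Import all_classical all_reals all_analysis.

Set Implicit Arguments.
Unset Strict Implicit.
Unset Printing Implicit Defensive.

Import Order.TTheory GRing.Theory Num.Theory.
Import numFieldNormedType.Exports.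

Local Open Scope classical_set_scope.
Local Open Scope ring_scope.

Definition strictly_concave_on (R : realType) (D : set R) (U : R -> R) : Prop :=
  forall x y t : R, D x -> D y -> x != y -> 0 < t < 1 ->
    t * U x + (1 - t) * U y < U (t * x + (1 - t) * y).

(* A utility function [0, oo) -> R is a function on R of which only the values
   on [0, oo) matter.  Continuity at 0 is not required. *)
Record utility (R : realType) (U : R -> R) : Prop := Utility {
  utility_increasing : {in `[0, +oo[ &, {homo U : x y / x < y}};
  utility_concave : strictly_concave_on `[0, +oo[ U;
  utility_derivable : {in `]0, +oo[, forall x, derivable U x 1};
  utility_derive_continuous : {in `]0, +oo[, continuous (derive1 U)};
  utility_bounded_below : has_lbound (U @` `[0, +oo[);
  utility0 : U 0 = 0;
  utility_inada0 : derive1 U x @[x --> 0^'+] --> +oo;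
  utility_inada_pinfty : derive1 U x @[x --> +oo] --> 0;
  utility_asymptotic_elasticity :
    (limf_esup (fun x : R => (x * derive1 U x / U x)%:E) +oo%R < 1)%E }.

(* I = (U')^-1, the inverse of U' restricted to (0, oo). *)
Definition inv_marginal (R : realType) (U : R -> R) : R -> R :=
  pinv (`]0, +oo[ : set R) (derive1 U : R -> R).

(* Suprema are taken in \bar R, since sup over R is 0 for unbounded sets. *)
Definition sup_above (R : realType) (a : R) (F : R -> R) : \bar R :=
  ereal_sup [set (F x)%:E | x in `]a, +oo[].

Definition maximizer_above (R : realType) (a : R) (F : R -> R) (x : R) : Prop :=
  a < x /\ forall z, a < z -> F z <= F x.

Definition decreasing_on (R : realType) (D : set R) (f : R -> \bar R) : Prop :=
  forall x y : R, D x -> D y -> x < y -> (f y < f x)%E.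

Definition increasing_on (R : realType) (D : set R) (f : R -> \bar R) : Prop :=
  forall x y : R, D x -> D y -> x < y -> (f x < f y)%E.

Definition zero_root (R : realType) (f : R -> \bar R) (y : R) : Prop :=
  0 < y /\ f y = 0%E.

Definition conj_c (R : realType) (U : R -> R) (lambda d y : R) : \bar R :=
  sup_above d (fun x => U (x - d) - x * lambda * y).

Definition conj_c2 (R : realType) (U : R -> R) (lambda lambda2 l d y : R)
    : \bar R :=
  sup_above d (fun x => U (x - d) - x * lambda * y
                        + lambda * y * (lambda2 * l / lambda)).

Definition conj_c3 (R : realType) (U : R -> R) (lambda lambda3 l d y : R)
    : \bar R :=
  sup_above d (fun x => U (x - d) - x * lambda * y + lambda3 * l).

Definition conj_c4 (R : realType) (U : R -> R) (lambda d y : R) : \bar R :=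
  sup_above (- d) (fun x => U (x + d) - x * lambda * y).

(* The condition d < dhat makes U' (dhat - d) meaningful. *)
Definition tangent_point (R : realType) (U : R -> R) (d dhat : R) : Prop :=
  d < dhat /\ U (dhat - d) / dhat = derive1 U (dhat - d).

Definition y_tangent (R : realType) (U : R -> R) (lambda d dhat : R) : R :=
  derive1 U (dhat - d) / lambda.

(* Main.v *)
Require Import Defs.
From mathcomp Require Import all_boot all_order all_algebra.
From mathcomp Require Import all_classical all_reals all_analysis.
From mathcomp Require Import ring lra.

Set Implicit Arguments.
Unset Strict Implicit.
Unset Printing Implicit Defensive.

Import Order.TTheory GRing.Theory Num.Theory.
Import numFieldNormedType.Exports.

Local Open Scope classical_set_scope.
Local Open Scope ring_scope.

(** Write T x w = U x + U' x (w - x) for the height above w of the tangent to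
    the graph of U at x.  Every function of y in the theorem is such a height:
    the supremum of U x - p x over x > 0 is attained where U' x = p, that is at
    x = I p, since the graph of U lies below its tangent there; its value
    U (I p) - p I p is the intercept T (I p) 0.  With p = lambda y, replacing
    the argument x of U by x - d and adding multiples of y or constants gives

      c y   = T (I p) (- d),             c2 y = T (I p) s,
      c3 y  = T (I p) (- d) + lambda3 l,   c4 y = T (I p) d.

    As y increases over (0, oo), the contact point x = I p decreases over the
    whole of (0, oo), because U' is a decreasing bijection of (0, oo) onto
    itself by strict concavity and the Inada conditions.  So all the claims are
    claims on T x w as a function of x for fixed w, and follow from these facts.

    - For x >= w the height T x w increases with x, for x <= w it decreases
      ([tangent_incr], [tangent_decr]): the tangents at x and z cross between
      x and z.  For w < 0 only the first case occurs, which gives the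
      monotonicity of c, the uniqueness of its root and the position of the
      other values of y relative to that root.  For w = d the turning point is
      x = d, i.e. y = U' d / lambda, where the tangent touches at height U d.
    - For w >= 0 the height is positive ([tangent_intercept_gt0]), so c2 has no
      root when s >= 0.
    - For w < 0 the height takes every value <= 0 ([tangent_attains_nonpos]):
      near x = 0 the steep slope drives it to -oo, and for large x the slope
      vanishes while the intercept T x 0 stays above T 1 0 > 0.  This gives the
      roots of c, of c2 when s < 0, and of c3.

    Finally dhat is a tangent point exactly when T (dhat - d) (- d) = 0
    ([tangent_pointE]), i.e. when the tangent of U (x - d) at dhat passes
    through the origin, so tangent points and roots of c correspond. *)

(** * Intermediate values on the positive half-line *)

(** The order of a and b is left open, so that the lemma serves for decreasing
    functions as well as for increasing ones. *)
Lemma IVT_gt0 (R : realType) (f : R -> R) (a b v : R) :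
    {in `]0, +oo[, continuous f} -> 0 < a -> 0 < b -> f a <= v -> v <= f b ->
  exists2 x, 0 < x & f x = v.
Proof.
move=> cf a0 b0 av vb.
have cfI (s t : R) : 0 < s -> {within `[s, t], continuous f}.
  move=> s0; apply: continuous_in_subspaceT => x; rewrite inE/= in_itv/=.
  move=> /andP[sx _].
  by apply: cf; rewrite in_itv/= andbT (lt_le_trans s0).
have [ab|ba] := leP a b.
- have [|x] := @IVT R f a b v ab (cfI _ _ a0).
    by rewrite ge_min av le_max vb orbT.
  by rewrite in_itv/= => /andP[ax _] fx; exists x => //; exact: lt_le_trans ax.
- have [|x] := @IVT R f b a v (ltW ba) (cfI _ _ b0).
    by rewrite ge_min av orbT le_max vb.
  by rewrite in_itv/= => /andP[ax _] fx; exists x => //; exact: lt_le_trans ax.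
Qed.

(** * Tangents to the graph of a utility function *)

Definition tangent (R : realType) (U : R -> R) (x w : R) : R :=
  U x + derive1 U x * (w - x).

Section utility_theory.
Variables (R : realType) (U : R -> R).
Hypothesis HU : utility U.

Local Notation U' := (derive1 U).
Local Notation I := (inv_marginal U).
Local Notation T := (tangent U).

(** Concavity bounds the difference quotient of U at x in the direction w - x
    from below by U w - U x; let the step tend to 0.  Using a directional
    derivative treats both sides of x at once. *)
Lemma utility_le_tangent (x w : R) : 0 < x -> 0 <= w -> U w <= T x w.
Proof.
move=> x0 w0; have [->|wx] := eqVneq w x.
  by rewrite /tangent subrr mulr0 addr0.
rewrite -lerBlDl.
have dU : differentiable U x.
  by apply/derivable1_diffP/(utility_derivable HU); rewrite in_itv/= x0.
have cD := diff_derivable (v := w - x) dU.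
(* U' x (w - x) is the derivative of U at x in the direction w - x. *)
have -> : U' x * (w - x) = 'D_(w - x) U x.
  by rewrite deriveE// diff1E// mulrC.
apply: (@cvgr_to_ge _ (0 : R)^'+ _ _ _ _ _ (cvg_dnbhs_at_right cD)).
near=> h.
have h0 : 0 < h by near: h; exact: nbhs_right_gt.
have h1 : h < 1 by near: h; exact: nbhs_right_lt.
rewrite /= /GRing.scale/= mulrC ler_pdivlMr//.
have := utility_concave HU (x := w) (y := x) (t := h).
rewrite /= !in_itv/= w0 (ltW x0) wx h0 h1 => /(_ isT isT isT isT).
have -> : h * w + (1 - h) * x = h * (w - x) + x by ring.
move=> H; rewrite mulrC; nra.
Unshelve. all: by end_near. Qed.

(** Passing to the limit loses strictness, which is recovered at the midpoint
    of x and w: there U exceeds the chord and is still below the tangent. *)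
Lemma utility_lt_tangent (x w : R) :
  0 < x -> 0 <= w -> w != x -> U w < T x w.
Proof.
move=> x0 w0 wx.
have h2 : 0 < (2^-1 : R) < 1 by apply/andP; split; lra.
have := utility_concave HU (x := w) (y := x) (t := 2^-1).
rewrite /= !in_itv/= w0 (ltW x0) wx => /(_ isT isT isT h2).
have m0 : 0 <= 2^-1 * w + (1 - 2^-1) * x by nra.
have := utility_le_tangent x0 m0.
rewrite /tangent; nra.
Qed.

Lemma derive1_utility_gt0 (x : R) : 0 < x -> 0 < U' x.
Proof.
move=> x0.
have := utility_lt_tangent (w := x + 1) x0.
have := utility_increasing HU (x := x) (y := x + 1).
rewrite !in_itv/= /tangent.
have -> : x + 1 != x by lra.
have -> : 0 <= x + 1 by lra.
have -> : 0 <= x by lra.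
have -> : x < x + 1 by lra.
move=> /(_ isT isT isT) ? /(_ isT isT); lra.
Qed.

(** Each of the two tangents lies strictly above the other contact point; add
    the two inequalities. *)
Lemma derive1_utility_decr (x z : R) : 0 < x -> x < z -> U' z < U' x.
Proof.
move=> x0 xz; have z0 : 0 < z by exact: lt_trans xz.
have h1 := utility_lt_tangent x0 (ltW z0) (negbT (gt_eqF xz)).
have h2 := utility_lt_tangent z0 (ltW x0) (negbT (lt_eqF xz)).
rewrite /tangent in h1 h2; nra.
Qed.

(** At the contact point x the tangent at z is above U x, and to the left of x it
    stays above because it is flatter than the tangent at x. *)
Lemma tangent_incr (x z w : R) : 0 < x -> w <= x -> x < z -> T x w < T z w.
Proof.
move=> x0 wx xz; have z0 : 0 < z by exact: lt_trans xz.
have h1 := derive1_utility_decr x0 xz.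
have h2 := utility_lt_tangent z0 (ltW x0) (negbT (lt_eqF xz)).
rewrite /tangent in h1 h2 *; nra.
Qed.

(** Mirror image of [tangent_incr]: to the right of z the steeper tangent at x
    stays above the tangent at z. *)
Lemma tangent_decr (x z w : R) : 0 < x -> x < z -> z <= w -> T z w < T x w.
Proof.
move=> x0 xz zw; have z0 : 0 < z by exact: lt_trans xz.
have h1 := derive1_utility_decr x0 xz.
have h2 := utility_lt_tangent x0 (ltW z0) (negbT (gt_eqF xz)).
rewrite /tangent in h1 h2 *; nra.
Qed.

(** Strict concavity makes the tangent at x pass above the point (0, U 0), which
    is the origin, and its slope is positive. *)
Lemma tangent_intercept_gt0 (x w : R) : 0 < x -> 0 <= w -> 0 < T x w.
Proof.
move=> x0 w0.
have h1 := utility_lt_tangent x0 (lexx 0) (negbT (lt_eqF x0)).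
have h2 := derive1_utility_gt0 x0.
rewrite (utility0 HU) /tangent in h1 *; nra.
Qed.

(** * Marginal utility as a decreasing bijection of the positive half-line *)

Lemma derive1_utility_large (A e : R) : 0 < e ->
  exists x, [/\ 0 < x, x < e & A <= U' x].
Proof.
move=> e0; apply: (@filter_ex _ (0 : R)^'+ _); near=> x; split; near: x.
- exact: nbhs_right_gt.
- exact: nbhs_right_lt.
- by move/cvgryPge : (utility_inada0 HU); apply.
Unshelve. all: by end_near. Qed.

Lemma derive1_utility_small (A e : R) : 0 < e -> exists2 x, A < x & U' x < e.
Proof.
move=> e0.
have [x []] : exists x, A < x /\ U' x < e.
  apply: (@filter_ex _ (pinfty_nbhs R) _); near=> x; split; near: x.
    by apply: nbhs_pinfty_gt; exact: num_real.
  exact: (cvgr_lt _ (utility_inada_pinfty HU)).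
by exists x.
Unshelve. all: by end_near. Qed.

Lemma derive1_utility_surj (z : R) : 0 < z -> exists2 x, 0 < x & U' x = z.
Proof.
move=> z0.
have [a [a0 _ za]] := derive1_utility_large z ltr01.
have [b b0 bz] := derive1_utility_small 0 z0.
exact: IVT_gt0 (utility_derive_continuous HU) b0 a0 (ltW bz) za.
Qed.

Lemma inv_marginalE (x : R) : 0 < x -> I (U' x) = x.
Proof.
move=> x0; rewrite /inv_marginal pinvKV//; last by rewrite inE/= in_itv/= x0.
move=> s t; rewrite !inE/= !in_itv/= !andbT => s0 t0 st.
have [h|h|//] := ltgtP s t.
- by move: (derive1_utility_decr s0 h); rewrite st ltxx.
- by move: (derive1_utility_decr t0 h); rewrite st ltxx.
Qed.

Lemma inv_marginalP (z : R) : 0 < z -> 0 < I z /\ U' (I z) = z.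
Proof. by move=> /derive1_utility_surj[x x0 <-]; rewrite inv_marginalE. Qed.

Lemma inv_marginal_decr (y z : R) : 0 < y -> y < z -> I z < I y.
Proof.
move=> y0 yz.
have [p1 e1] := inv_marginalP y0.
have [p2 e2] := inv_marginalP (lt_trans y0 yz).
rewrite ltNge; apply/negP; rewrite le_eqVlt => /orP[/eqP h|h].
- by move: yz; rewrite -e1 -e2 h ltxx.
- by move: (derive1_utility_decr p1 h); rewrite e1 e2; lra.
Qed.

(** * Heights attained by the tangents to the left of the origin *)

Lemma tangent_continuous (w : R) : {in `]0, +oo[, continuous (T ^~ w)}.
Proof.
move=> x x0.
have cU : {for x, continuous U}.
  exact/differentiable_continuous/derivable1_diffP/(utility_derivable HU).
apply: cvgD; first exact: cU.
apply: cvgM; first exact: (utility_derive_continuous HU).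
by apply: cvgB; [exact: cvg_cst|exact: cvg_id].
Qed.

(** Intermediate values of x -> T x w.  Near 0 the term w U' x tends to -oo while
    U x, which may have a positive limit at 0, stays below U 1; at infinity
    w U' x vanishes while the intercept T x 0 stays above T 1 0 > 0. *)
Lemma tangent_attains_nonpos (w k : R) : w < 0 -> 0 <= k ->
  exists2 x, 0 < x & T x w = - k.
Proof.
move=> w0 k0.
(* The slope is chosen so that U 1 + w U' a <= - k. *)
have [a [a0 a1 Ua]] := derive1_utility_large (- (U 1 + k) / w) ltr01.
have e0 := tangent_intercept_gt0 ltr01 (lexx 0).
have ew : 0 < T 1 0 / - w by rewrite divr_gt0// oppr_gt0.
(* The slope is chosen so that T 1 0 + w U' b > 0. *)
have [b b1 Ub] := derive1_utility_small 1 ew.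
have b0 : 0 < b by lra.
apply: (IVT_gt0 (tangent_continuous (w := w)) a0 b0).
- have : U a < U 1.
    by apply: (utility_increasing HU); rewrite ?in_itv/= ?andbT ?ltW.
  have := derive1_utility_gt0 a0.
  move: Ua; rewrite mulNr -mulrN -invrN ler_pdivrMr ?oppr_gt0// /tangent.
  nra.
- have := tangent_incr ltr01 ler01 b1.
  have := derive1_utility_gt0 b0.
  move: Ub; rewrite ltr_pdivlMr ?oppr_gt0// => Ub.
  have -> : T b w = T b 0 + U' b * w by rewrite /tangent; ring.
  lra.
Qed.

End utility_theory.

(** * Conjugate functions as heights of tangents *)

Lemma sup_above_maximizer (R : realType) (a : R) (F : R -> R) (x : R) :
  maximizer_above a F x -> sup_above a F = (F x)%:E.
Proof.
move=> [ax maxF]; apply/eqP; rewrite eq_le; apply/andP; split.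
- apply: ge_ereal_sup => _ [z /= + <-]; rewrite in_itv/= andbT => az.
  by rewrite lee_fin maxF.
- by apply: ereal_sup_ubound; exists x => //=; rewrite in_itv/= ax.
Qed.

Section conjugate.
Variables (R : realType) (U : R -> R).
Hypothesis HU : utility U.

Local Notation U' := (derive1 U).
Local Notation I := (inv_marginal U).
Local Notation T := (tangent U).

Lemma tangent_inv_marginal (p w : R) : 0 < p ->
  T (I p) w = U (I p) - p * I p + p * w.
Proof. by move=> /(inv_marginalP HU)[_ e]; rewrite /tangent e; ring. Qed.

Lemma maximizer_inv_marginal (a p k : R) (F : R -> R) :
    0 < p -> (forall x, F x = U (x - a) - x * p + k) ->
  maximizer_above a F (I p + a).
Proof.
move=> p0 FE; have [I0 e] := inv_marginalP HU p0.
split=> [|z az]; first by rewrite ltrDr.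
have z0 : 0 <= z - a by rewrite subr_ge0 ltW.
have := utility_le_tangent HU I0 z0; rewrite /tangent e !FE addrK; lra.
Qed.

(** The common form of all the conjugate functions: a is the shift of the
    utility, p the price, and k collects the terms independent of x.  The
    equation on F is a hypothesis because the integrands associate their
    products differently. *)
Lemma sup_above_tangent (a p k : R) (F : R -> R) :
    0 < p -> (forall x, F x = U (x - a) - x * p + k) ->
  sup_above a F = (T (I p) (- a) + k)%:E.
Proof.
move=> p0 FE; rewrite (sup_above_maximizer (maximizer_inv_marginal p0 FE)) FE.
by rewrite addrK tangent_inv_marginal//; congr (_%:E); ring.
Qed.

(** The tangent to the shifted graph of U (x - d) passes through the origin when
    that of U passes through (- d, 0). *)
Lemma tangent_pointE (d dhat : R) : 0 < d ->
  tangent_point U d dhat <-> 0 < dhat - d /\ T (dhat - d) (- d) = 0.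
Proof.
move=> d0; rewrite /tangent_point /tangent subr_gt0; split=> -[dd e]; split=> //.
- have h : dhat != 0 by rewrite gt_eqF// (lt_trans d0).
  by rewrite -e; field.
- have h : dhat != 0 by rewrite gt_eqF// (lt_trans d0).
  have -> : U (dhat - d) = derive1 U (dhat - d) * dhat by lra.
  by rewrite mulfK.
Qed.

Variable lambda : R.
Hypothesis lambda_gt0 : 0 < lambda.

Lemma inv_marginal_mul_decr (y z : R) : 0 < y -> y < z ->
  0 < I (lambda * z) /\ I (lambda * z) < I (lambda * y).
Proof.
move=> y0 yz; have z0 := lt_trans y0 yz.
by split; [apply: (inv_marginalP HU _).1; rewrite mulr_gt0
          |apply: (inv_marginal_decr HU); rewrite ?mulr_gt0// ltr_pM2l].
Qed.

Lemma price_of_demand (x : R) : 0 < x ->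
  0 < U' x / lambda /\ I (lambda * (U' x / lambda)) = x.
Proof.
move=> x0; have h := derive1_utility_gt0 HU x0; split; first by rewrite divr_gt0.
by rewrite mulrC divfK ?gt_eqF// inv_marginalE.
Qed.

(** The root is found as a contact point x, where continuity of U and U' is
    available, and then translated into the price y = U' x / lambda. *)
Lemma tangent_zero_root (w k : R) (f : R -> \bar R) :
    w < 0 -> 0 <= k ->
    (forall y, 0 < y -> f y = (T (I (lambda * y)) w + k)%:E) ->
  exists y, zero_root f y.
Proof.
move=> w0 k0 fE.
have [x x0 Tx] := tangent_attains_nonpos HU w0 k0.
have [y0 yx] := price_of_demand x0.
by exists (U' x / lambda); split=> //; rewrite fE// yx Tx addNr.
Qed.

End conjugate.

(** * Properties of the conjugate functions *)

Theorem lemmaA2 (R : realType) (U : R -> R) (HU : utility U)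
    (lambda d : R) (lambda_gt0 : 0 < lambda) (d_gt0 : 0 < d) :
  let I := inv_marginal U in
  let U' := derive1 U in
  let c := conj_c U lambda d in
  let yhat := y_tangent U lambda d in
  (* formula for c, and (i) *)
  [/\ (forall y, 0 < y ->
         c y = (U (I (lambda * y)) - lambda * y * I (lambda * y)
                - lambda * y * d)%:E)
    & decreasing_on `]0, +oo[ c]
  /\
  (* (ii) *)
  [/\ exists dhat, tangent_point U d dhat
    & forall dhat, tangent_point U d dhat ->
        zero_root c (yhat dhat) /\
        (forall y, zero_root c y -> y = yhat dhat)]
  /\
  (* (iii) *)
  (forall dhat, tangent_point U d dhat ->
     forall y, yhat dhat < y ->
       let x := I (lambda * y) + d in
       U (x - d) / x - U' (x - d) < 0)
  /\
  (* (iv) *)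
  (forall lambda2 l, 0 < lambda2 -> 0 < l ->
     let c2 := conj_c2 U lambda lambda2 l d in
     let s := lambda2 * l / lambda - d in
     [/\ (forall y, 0 < y ->
            c2 y = (U (I (lambda * y)) - lambda * y * I (lambda * y)
                    - lambda * y * d
                    + lambda * y * (lambda2 * l / lambda))%:E)
       & (exists y, zero_root c2 y) <-> s < 0])
  /\
  (* (v) *)
  (forall lambda3 l, 0 < lambda3 -> 0 < l ->
     let c3 := conj_c3 U lambda lambda3 l d in
     [/\ (forall y, 0 < y -> c3 y = (c y + (lambda3 * l)%:E)%E),
         (exists y, zero_root c3 y)
       & forall dhat, tangent_point U d dhat ->
           forall y, zero_root c3 y -> yhat dhat < y])
  /\
  (* (vi) *)
  (let c4 := conj_c4 U lambda d in
   [/\ (forall y, 0 < y ->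
          c4 y = (U (I (lambda * y)) - lambda * y * I (lambda * y)
                  + lambda * y * d)%:E),
       (forall y, 0 < y ->
          maximizer_above (- d) (fun x => U (x + d) - x * lambda * y)
            (I (lambda * y) - d)),
       decreasing_on `]0, U' d / lambda[ c4,
       increasing_on `]U' d / lambda, +oo[ c4
     & (exists2 y, 0 < y & c4 y = (U d)%:E) /\
       (forall y, 0 < y -> ((U d)%:E <= c4 y)%E)]).
Proof.
move=> I U' c yhat; subst I U'.
have cE y : 0 < y -> c y = (tangent U (inv_marginal U (lambda * y)) (- d))%:E.
  move=> y0; rewrite /c /conj_c.
  rewrite (sup_above_tangent HU (a := d) (p := lambda * y) (k := 0)) ?mulr_gt0//.
    by rewrite addr0.
  by move=> x; rewrite mulrA addr0.
have Nd_lt0 : - d < 0 by rewrite oppr_lt0.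
have c_decr : decreasing_on `]0, +oo[ c.
  move=> y z /=; rewrite !in_itv/= !andbT => y0 z0 yz.
  rewrite !cE// lte_fin.
  have [I0 II] := inv_marginal_mul_decr HU lambda_gt0 y0 yz.
  by apply: (tangent_incr HU) => //; rewrite ltW// (lt_trans Nd_lt0).
have c_lt y z : 0 < y -> y < z -> (c z < c y)%E.
  by move=> y0 yz; apply: c_decr => //=; rewrite in_itv/= ?y0// (lt_trans y0).
have hat_root dhat : tangent_point U d dhat -> zero_root c (yhat dhat).
  move=> /(tangent_pointE U _ d_gt0)[x0 Tx].
  have [y0 yx] := price_of_demand HU lambda_gt0 x0.
  by split=> //; rewrite cE// /yhat /y_tangent yx Tx.
split.
  split=> // y y0; rewrite cE// tangent_inv_marginal ?mulr_gt0//.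
  by congr (_%:E); ring.
split.
  split.
    have [x x0 Tx] := tangent_attains_nonpos HU Nd_lt0 (lexx 0).
    by exists (x + d); apply/(tangent_pointE U) => //; rewrite addrK Tx oppr0.
  move=> dhat /hat_root root_hat; split=> // y [y0 cy].
  have [h0 ch] := root_hat.
  case: (ltgtP y (yhat dhat)) => // h.
    by have := c_lt _ _ y0 h; rewrite cy ch ltxx.
  by have := c_lt _ _ h0 h; rewrite cy ch ltxx.
split.
  move=> dhat /hat_root[h0 ch] y hy.
  set x := inv_marginal U (lambda * y) + d; rewrite /=.
  have y0 := lt_trans h0 hy.
  have := c_lt _ _ h0 hy; rewrite ch cE// lte_fin.
  have [I0 _] := inv_marginalP HU (mulr_gt0 lambda_gt0 y0).
  have x0 : 0 < x by rewrite /x addr_gt0.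
  (* Multiplied by x, the claim is c y < 0. *)
  rewrite subr_lt0 ltr_pdivrMr// /tangent /x addrK.
  by rewrite -[_ < _ * _]subr_lt0; congr (_ < _); ring.
split.
  move=> lambda2 l _ _ c2 s.
  have c2E y : 0 < y -> c2 y = (tangent U (inv_marginal U (lambda * y)) s)%:E.
    move=> y0; rewrite /c2 /conj_c2.
    rewrite (sup_above_tangent HU (a := d) (p := lambda * y)
      (k := lambda * y * (lambda2 * l / lambda))) ?mulr_gt0//.
      by rewrite !tangent_inv_marginal ?mulr_gt0// /s; congr (_%:E); ring.
    by move=> x; rewrite (mulrA x).
  split=> [y y0|].
    by rewrite c2E// tangent_inv_marginal ?mulr_gt0// /s; congr (_%:E); ring.
  split=> [[y [y0]]|s0]; last first.
    apply: (tangent_zero_root HU lambda_gt0 s0 (lexx 0)) => y y0.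
    by rewrite c2E// addr0.
  rewrite c2E// => -[Ts]; rewrite ltNge; apply/negP => s0.
  have [I0 _] := inv_marginalP HU (mulr_gt0 lambda_gt0 y0).
  by have := tangent_intercept_gt0 HU I0 s0; rewrite Ts ltxx.
split.
  move=> lambda3 l lambda3_gt0 l_gt0 c3.
  have k0 : 0 < lambda3 * l by rewrite mulr_gt0.
  have c3E y : 0 < y ->
      c3 y = (tangent U (inv_marginal U (lambda * y)) (- d) + lambda3 * l)%:E.
    move=> y0; rewrite /c3 /conj_c3.
    rewrite (sup_above_tangent HU (a := d) (p := lambda * y) (k := lambda3 * l))
      ?mulr_gt0//.
    by move=> x; rewrite mulrA.
  split=> [y y0||dhat /hat_root[h0 ch] y [y0 c3y]].
  - by rewrite c3E// cE.
  - exact: (tangent_zero_root HU lambda_gt0 Nd_lt0 (ltW k0)).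
  - (* c y = - lambda3 * l < 0 = c (yhat dhat). *)
    have cy : (c y < c (yhat dhat))%E.
      by move: c3y; rewrite ch c3E// cE// => -[/eqP]; rewrite lte_fin; lra.
    case: (ltgtP y (yhat dhat)) => // [h|h].
    - by move: (lt_trans (c_lt _ _ y0 h) cy); rewrite ltxx.
    - by move: cy; rewrite h ltxx.
move=> c4.
have F4 y x : U (x + d) - x * lambda * y = U (x - - d) - x * (lambda * y) + 0.
  by rewrite opprK mulrA addr0.
have c4E y : 0 < y -> c4 y = (tangent U (inv_marginal U (lambda * y)) d)%:E.
  move=> y0; rewrite /c4 /conj_c4.
  by rewrite (sup_above_tangent HU _ (F4 y)) ?mulr_gt0// opprK addr0.
have [yd0 Iyd] := price_of_demand HU lambda_gt0 d_gt0.
split.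
- by move=> y y0; rewrite c4E// tangent_inv_marginal ?mulr_gt0.
- by move=> y y0; apply: (maximizer_inv_marginal HU _ (F4 y)); rewrite mulr_gt0.
- move=> y z /=; rewrite !in_itv/= => /andP[y0 _] /andP[z0 zd] yz.
  rewrite !c4E// lte_fin.
  have [I0 II] := inv_marginal_mul_decr HU lambda_gt0 y0 yz.
  have [_] := inv_marginal_mul_decr HU lambda_gt0 z0 zd.
  by rewrite Iyd => /ltW Id; exact: (tangent_incr HU).
- move=> y z /=; rewrite !in_itv/= !andbT => yd zd yz.
  have y0 := lt_trans yd0 yd; have z0 := lt_trans yd0 zd.
  rewrite !c4E// lte_fin.
  have [I0 II] := inv_marginal_mul_decr HU lambda_gt0 y0 yz.
  have [_] := inv_marginal_mul_decr HU lambda_gt0 yd0 yd.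
  by rewrite Iyd => /ltW Id; exact: (tangent_decr HU).
- split.
    exists (derive1 U d / lambda) => //.
    by rewrite c4E// Iyd /tangent subrr mulr0 addr0.
  move=> y y0; rewrite c4E// lee_fin.
  have [I0 _] := inv_marginalP HU (mulr_gt0 lambda_gt0 y0).
  by apply: (utility_le_tangent HU I0); exact: ltW.
Qed.
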